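(* Let $t(n,k)$ be the number of paths in $\mathcal{M}_1$ of length $n$ whose end-point has height $k$. The matrix $\mathcal{T}=[t(n,k)]_{n\geq 0, k \geq 0}$ is the Riordan array $$\left(\frac{1}{1-z^2}\,C\!\left(\frac{z(1-z+z^2)}{(1-z^2)^2}\right),\ \frac{z}{1-z^2}\,C\!\left(\frac{z(1-z+z^2)}{(1-z^2)^2}\right)\right),$$ where $C(z)=\frac{1-\sqrt{1-4z}}{2z}$ is the generating function of the Catalan numbers $c_n=\frac{1}{n+1}\binom{2n}{n}$.
   Context: Let $U=(1,1)$, $H=(1,0)$ and $D_k=(1,-k)$ for $k\ge 1$ (down steps). $\mathcal{M}_1$ is the set of lattice paths in $\mathbb{N}^2$ (with $\mathbb{N}=\{0,1,2,\dots\}$, so paths never go below the $x$-axis) starting at the origin, made of steps $U$, $H$ and $D_k$ ($k\ge1$), in which two down steps are never consecutive. The empty path belongs to $\mathcal{M}_1$. The length of a path is its number of steps; the height of a point is its ordinate. For formal power series $g,f$ with $g(0)\ne0$, $f(0)=0$, $f'(0)\neq0$, the Riordan array $(g(z),f(z))$ is the infinite lower triangular matrix whose $k$-th column ($k\ge0$) has generating function $g(z)f(z)^k$. *)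

(* Defs.v *)
From HB Require Import structures.
From mathcomp Require Export all_boot all_order all_algebra.
From mathcomp Require Export finmap boolp classical_sets cardinality.
From mathcomp Require Import zify.

Set Implicit Arguments.
Unset Strict Implicit.
Unset Printing Implicit Defensive.

Import GRing.Theory Num.Theory.
Local Open Scope ring_scope.

(* A record rather than an alias of [nat -> K], because functions already carry
   the pointwise ring structure. *)
Record fps (K : fieldType) := Fps { coef_fps :> nat -> K }.
Arguments Fps {K} _.

Section FormalPowerSeries.
Variable K : fieldType.
Implicit Types f g h : fps K.

Lemma fpsP f g : (forall n, f n = g n) -> f = g.
Proof. by case: f g => f [g] /= /funext ->. Qed.

HB.instance Definition _ := gen_eqMixin (fps K).
HB.instance Definition _ := gen_choiceMixin (fps K).

Definition fpsC (a : K) : fps K := Fps (fun n => if n == 0%N then a else 0).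
Definition fpsX : fps K := Fps (fun n => (n == 1%N)%:R).
Definition fps_add f g : fps K := Fps (fun n => f n + g n).
Definition fps_opp f : fps K := Fps (fun n => - f n).
Definition fps_mul f g : fps K :=
  Fps (fun n => \sum_(i < n.+1) f i * g (n - i)%N).

Fact fps_addA : associative fps_add.
Proof. by move=> f g h; apply: fpsP => n; rewrite /= addrA. Qed.
Fact fps_addC : commutative fps_add.
Proof. by move=> f g; apply: fpsP => n; rewrite /= addrC. Qed.
Fact fps_add0 : left_id (fpsC 0) fps_add.
Proof. by move=> f; apply: fpsP => n; rewrite /= if_same add0r. Qed.
Fact fps_addN : left_inverse (fpsC 0) fps_opp fps_add.
Proof. by move=> f; apply: fpsP => n; rewrite /= if_same addNr. Qed.

HB.instance Definition _ :=
  GRing.isZmodule.Build (fps K) fps_addA fps_addC fps_add0 fps_addN.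

Definition fps_trunc m f : {poly K} := \poly_(i < m) f i.

Lemma coef_fps_trunc m f n : (n < m)%N -> (fps_trunc m f)`_n = f n.
Proof. by move=> lt_nm; rewrite coef_poly lt_nm. Qed.

Lemma fps_mul_trunc m f g n : (n < m)%N ->
  fps_mul f g n = (fps_trunc m f * fps_trunc m g)`_n.
Proof.
move=> lt_nm; rewrite coefM /=; apply: eq_bigr => i _.
have le_in : (i <= n)%N by rewrite -ltnS.
by rewrite !coef_fps_trunc // (leq_ltn_trans _ lt_nm) // leq_subr.
Qed.

Fact fps_mulC : commutative fps_mul.
Proof.
by move=> f g; apply: fpsP => n; rewrite !(fps_mul_trunc _ _ (ltnSn n)) mulrC.
Qed.

Fact fps_mulA : associative fps_mul.
Proof.
move=> f g h; apply: fpsP => n; rewrite !(fps_mul_trunc _ _ (ltnSn n)).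
have -> : (fps_trunc n.+1 f * fps_trunc n.+1 (fps_mul g h))`_n
    = (fps_trunc n.+1 f * (fps_trunc n.+1 g * fps_trunc n.+1 h))`_n.
  rewrite !(coefM (fps_trunc n.+1 f)); apply: eq_bigr => i _; congr (_ * _).
  have lt_n : (n - i < n.+1)%N by rewrite ltnS leq_subr.
  by rewrite coef_fps_trunc // (fps_mul_trunc _ _ lt_n).
rewrite mulrA !(coefMr _ (fps_trunc n.+1 h)); apply: eq_bigr => i _.
congr (_ * _).
have lt_n : (n - i < n.+1)%N by rewrite ltnS leq_subr.
by rewrite coef_fps_trunc // (fps_mul_trunc _ _ lt_n).
Qed.

Fact fps_mul1 : left_id (fpsC 1) fps_mul.
Proof.
move=> f; apply: fpsP => n.
rewrite /= big_ord_recl /= mul1r subn0 big1 ?addr0 // => i _.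
by rewrite /= mul0r.
Qed.

Fact fps_mulDl : left_distributive fps_mul fps_add.
Proof.
move=> f g h; apply: fpsP => n /=.
by rewrite -big_split; apply: eq_bigr => i _; rewrite mulrDl.
Qed.

Fact fps_oner_neq0 : fpsC 1 != 0.
Proof.
apply/eqP => /(congr1 (fun f : fps K => f 0%N)) /= /eqP.
by rewrite oner_eq0.
Qed.

HB.instance Definition _ := GRing.Zmodule_isComNzRing.Build (fps K)
  fps_mulA fps_mulC fps_mul1 fps_mulDl fps_oner_neq0.

Lemma fpsCE a n : fpsC a n = if n == 0%N then a else 0. Proof. by []. Qed.
Lemma coef_fps0 n : (0 : fps K) n = 0. Proof. exact: if_same. Qed.
Lemma coef_fps1 n : (1 : fps K) n = (n == 0%N)%:R.
Proof. by rewrite [LHS]fpsCE; case: eqP. Qed.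
Lemma coef_fpsD f g n : (f + g) n = f n + g n. Proof. by []. Qed.
Lemma coef_fpsN f n : (- f) n = - f n. Proof. by []. Qed.
Lemma coef_fpsM f g n : (f * g) n = \sum_(i < n.+1) f i * g (n - i)%N.
Proof. by []. Qed.

Lemma coef_fps_sum (I : Type) (r : seq I) (P : pred I) (F : I -> fps K) n :
  (\sum_(i <- r | P i) F i) n = \sum_(i <- r | P i) F i n.
Proof.
by apply: (big_morph (fun f : fps K => f n)) => //; exact: coef_fps0.
Qed.

Lemma coef_fpsX_small f k n : f 0%N = 0 -> (n < k)%N -> (f ^+ k) n = 0.
Proof.
move=> f0; elim: k n => // k IHk n lt_nk; rewrite exprS coef_fpsM.
rewrite big_ord_recl f0 mul0r add0r big1 // => i _.
rewrite IHk ?mulr0 //= /bump /= add1n.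
have lt_in := ltn_ord i.
by rewrite -ltnS (leq_trans _ lt_nk) // ltnS subnS prednK ?leq_subr ?subn_gt0.
Qed.

(* f(g(z)), meaningful when g(0) = 0: then g ^+ k has no coefficient below k, so
   only the terms k <= n of \sum_k f_k g^k contribute to the coefficient n. *)
Definition fps_comp f g : fps K :=
  Fps (fun n => \sum_(k < n.+1) f k * (g ^+ k) n).

(* 1/f = f(0)^-1 * (1/(1-z) evaluated at 1 - f(0)^-1 * f) *)
Definition fps_inv f : fps K :=
  if f 0%N == 0 then f else
  fpsC (f 0%N)^-1 * fps_comp (Fps (fun=> 1)) (1 - fpsC (f 0%N)^-1 * f).

Lemma coef_fpsCM a f n : (fpsC a * f) n = a * f n.
Proof.
rewrite coef_fpsM big_ord_recl /= subn0 big1 ?addr0 // => i _.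
by rewrite mul0r.
Qed.

Lemma fps_geom h : h 0%N = 0 -> (1 - h) * fps_comp (Fps (fun=> 1)) h = 1.
Proof.
move=> h0; apply: fpsP => n.
have -> : ((1 - h) * fps_comp (Fps (fun=> 1)) h) n
    = ((1 - h) * \sum_(k < n.+1) h ^+ k) n.
  rewrite !coef_fpsM; apply: eq_bigr => i _; congr (_ * _).
  rewrite coef_fps_sum /=.
  have le_n : ((n - i).+1 <= n.+1)%N by rewrite ltnS leq_subr.
  rewrite (big_ord_widen _ (fun k => 1 * (h ^+ k) (n - i)%N) le_n) big_mkcond /=.
  apply: eq_bigr => k _; case: ltnP => [_|lt_nk]; first by rewrite mul1r.
  by rewrite coef_fpsX_small.
rewrite -opprB mulNr -subrX1 opprB coef_fpsD coef_fpsN.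
by rewrite coef_fpsX_small // subr0.
Qed.

Definition fps_unit : {pred fps K} := fun f => f 0%N != 0.

Fact fps_mulVf : {in fps_unit, left_inverse 1 fps_inv *%R}.
Proof.
move=> f; rewrite unfold_in => f0; rewrite /fps_inv (negPf f0).
rewrite mulrAC -[X in X * _](subKr 1) fps_geom //.
by rewrite coef_fpsD coef_fpsN coef_fpsCM coef_fps1 mulVf // subrr.
Qed.

Fact fps_unitPl f g : g * f = 1 -> fps_unit f.
Proof.
move=> /(congr1 (fun h : fps K => h 0%N)).
rewrite coef_fpsM big_ord_recl big_ord0 addr0 coef_fps1 /= => gf1.
apply/eqP => f0; move/eqP: gf1.
by rewrite f0 mulr0 eq_sym oner_eq0.
Qed.

Fact fps_inv_out : {in [predC fps_unit], fps_inv =1 id}.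
Proof. by move=> f; rewrite inE unfold_in negbK /fps_inv => ->. Qed.

HB.instance Definition _ := GRing.ComNzRing_hasMulInverse.Build (fps K)
  fps_mulVf fps_unitPl fps_inv_out.

(* s = sqrt(f): the square root with constant term 1 (for f(0) = 1) *)
Definition is_fps_sqrt (s f : fps K) : Prop := s 0%N = 1 /\ s ^+ 2 = f.

Definition riordan_pair (g f : fps K) : Prop :=
  [/\ g 0%N != 0, f 0%N = 0 & f 1%N != 0].

Definition riordan (g f : fps K) (n k : nat) : K := (g * f ^+ k) n.

End FormalPowerSeries.

Arguments fpsX {K}.

Definition catalan_fps : fps rat := Fps (fun n => ('C(n.*2, n))%:R / (n.+1)%:R).

Local Open Scope classical_set_scope.

Definition stepU : int * int := (1, 1).
Definition stepH : int * int := (1, 0).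
Definition stepD (k : nat) : int * int := (1, - k%:Z).

Definition down_steps : set (int * int) :=
  [set s | exists2 k : nat, (1 <= k)%N & s = stepD k].

(* A path starting at the origin is encoded by the sequence of its steps;
   [path_point p i] is the point reached after i steps. *)
Definition path_point (p : seq (int * int)) (i : nat) : int * int :=
  \sum_(s <- take i p) s.

Definition end_height (p : seq (int * int)) : int := (path_point p (size p)).2.

Definition M1 : set (seq (int * int)) := [set p |
  [/\ forall s, s \in p -> s = stepU \/ s = stepH \/ down_steps s,
      forall i, (i <= size p)%N ->
        0 <= (path_point p i).1 /\ 0 <= (path_point p i).2
    & forall i, (i.+1 < size p)%N ->
        ~ (down_steps (nth 0 p i) /\ down_steps (nth 0 p i.+1))]].

Definition M1_paths (n k : nat) : set (seq (int * int)) :=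
  [set p | [/\ M1 p, size p = n & end_height p = k%:Z]].

Lemma path_pointS p i : (i < size p)%N ->
  path_point p i.+1 = path_point p i + nth 0 p i.
Proof. by move=> lt_ip; rewrite /path_point (take_nth 0) // big_rcons. Qed.

Lemma path_point_le p i : M1 p -> (i <= size p)%N ->
  (path_point p i).2 <= i%:Z.
Proof.
case=> steps_p _ _; elim: i => [_|i IHi lt_ip].
  by rewrite /path_point take0 big_nil.
rewrite path_pointS //=; move: (IHi (ltnW lt_ip)).
by case: (steps_p _ (mem_nth 0 lt_ip)) => [->|[->|[k _ ->]]] /=; lia.
Qed.

Lemma M1_step_bound p s : M1 p -> s \in p ->
  exists2 j : 'I_(size p).+2, s.1 = 1 & s.2 = 1 - (j : nat)%:Z.
Proof.
move=> Mp; case: (Mp) => steps_p pos_p _ s_p.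
case: (steps_p _ s_p) => [->|[->|[k k_gt0 def_s]]].
- by exists ord0.
- by exists (inord 1); rewrite // inordK.
suffices le_kp : (k <= size p)%N.
  by exists (inord k.+1); rewrite def_s //= inordK //; lia.
have lt_ip : (index s p < size p)%N by rewrite index_mem.
have [_] := pos_p _ lt_ip; rewrite path_pointS // nth_index // def_s /=.
have := path_point_le Mp (ltnW lt_ip); rewrite def_s in lt_ip *; lia.
Qed.

Lemma finite_M1_paths n k : finite_set (M1_paths n k).
Proof.
pose F (u : n.-tuple 'I_n.+2) := 
  [seq (1, 1 - (j : nat)%:Z) : int * int | j : 'I_n.+2 <- u].
apply: (@sub_finite_set _ _ (F @` setT)); last first.
  exact/finite_image/finite_finset.
move=> p [Mp sz_p _]; move: Mp; case: n / sz_p @F => F Mp.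
pose u : (size p).-tuple 'I_(size p).+2 :=
  [tuple inord `|1 - (tnth (in_tuple p) i).2|%N | i < size p].
exists u => //; apply: (@eq_from_nth _ 0); first by rewrite size_map size_tuple.
move=> i; rewrite size_map size_tuple => lt_ip.
rewrite (nth_map ord0) ?size_tuple // -[i]/(val (Ordinal lt_ip)) -tnth_nth.
rewrite tnth_mktuple (tnth_nth 0) /=.
have [j s1 s2] := M1_step_bound Mp (mem_nth 0 lt_ip).
rewrite s2 subKr absz_nat inord_val.
by move: s1 s2; case: (nth _ _ _) => a b /= -> ->.
Qed.

(* [fset_set] returns the empty set on infinite sets; [finite_M1_paths] excludes
   this case. *)
Definition M1_count (n k : nat) : nat := #|` fset_set (M1_paths n k)|%fset.

(* Main.v *)
From HB Require Import structures.
Require Import Defs.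
From mathcomp Require Import zify.
From Stdlib Require Import Ring.

Set Implicit Arguments.
Unset Strict Implicit.
Unset Printing Implicit Defensive.

Import GRing.Theory Num.Theory.
Local Open Scope ring_scope.

(** Let A_k and B_k be the generating functions, by length, of the paths ending
    at height k whose last step is not, respectively is, a down step; the empty
    path is counted by A_0.  Write T_k = A_k + B_k.  Removing the last step gives
      A_0 = 1 + z T_0,   A_{k+1} = z (T_{k+1} + T_k),
      B_k = z (A_{k+1} + A_{k+2} + ...),
    since a down step can only follow a path counted by some A_j.  These
    relations determine all the coefficients by induction on the length
    ([size_M1_enum]), so it is enough to find one solution.

    Try T_k = g f^k with f = z g.  The first two relations then force A_k, hence
    B_k = T_k - A_k, which turns out to be f^k (g - 1 - z g).  Since g(0) = 1,
    this is divisible by z^(k+1), so the third relation is equivalent to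
    B_k = z A_{k+1} + B_{k+1} for all k, and this identity holds as soon as
      (1 - z^2) g = 1 + z (1 - z + z^2) g^2     ([down_fpsS]).
    The Catalan series satisfies C = 1 + z C^2 ([catalan_eq]).  Composition is
    multiplicative ([fps_compM]), so c = C(w) satisfies c = 1 + w c^2; taking
    w = z (1 - z + z^2) / (1 - z^2)^2 and g = c / (1 - z^2) yields exactly this
    quadratic equation.

    That C is (1 - sqrt(1 - 4 z)) / (2 z) is obtained from a differential
    equation: with theta = z d/dz, the series s = 1 - 2 z C satisfies
    (1 - 4 z) theta s = - 2 z s, so that s^2 and 1 - 4 z are solutions with
    constant term 1 of the same first-order equation
    (1 - 4 z) theta y = - 4 z y.  The equation C = 1 + z C^2 is then read off
    s^2 = 1 - 4 z. *)

(** * Formal power series *)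

Section PowerSeries.
Variable K : fieldType.
Implicit Types (f g h : fps K) (p q : {poly K}).

Fact fps_ring_theory :
  ring_theory (fpsC (0 : K)) (fpsC 1) (@fps_add K) (@fps_mul K)
    (fun f g => fps_add f (fps_opp g)) (@fps_opp K) eq.
Proof.
split=> //; [exact: add0r|exact: addrC|exact: addrA|exact: mul1r|exact: mulrC
  |exact: mulrA|exact: mulrDl|exact: subrr].
Qed.

(* The reflexive ring tactic recognizes operations syntactically, so the
   structure projections are first replaced by the concrete operations. *)
Fact fps_ringE :
  ((forall f g : fps K, (f + g)%R = fps_add f g) *
   (forall f g : fps K, (f * g)%R = fps_mul f g) *
   (forall f : fps K, (- f)%R = fps_opp f) *
   (1%R = fpsC (1 : K)) * (0%R = fpsC (0 : K)))%type.
Proof. by []. Qed.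

Add Ring fps_ring : fps_ring_theory.

Ltac fps_ring :=
  rewrite ?expr2 ?(natrD _ 2 2) ?mulr2n ?fps_ringE;
  match goal with |- @eq _ ?a ?b => change (@eq (fps K) a b) end; ring.

Lemma coef_fpsM0 f g : (f * g) 0%N = f 0%N * g 0%N.
Proof. by rewrite coef_fpsM big_ord1. Qed.

Lemma coef_fpsXM f n :
  (fpsX * f) n = if n is m.+1 then f m else 0.
Proof.
case: n => [|n]; first by rewrite coef_fpsM0 mul0r.
rewrite coef_fpsM big_ord_recl mul0r add0r big_ord_recl mul1r subn1 /=.
by rewrite big1 ?addr0 // => i _; rewrite mul0r.
Qed.

Lemma fpsXM_inj f g : fpsX * f = fpsX * g -> f = g.
Proof.
move=> eq_fg; apply: fpsP => n.
by have := coef_fpsXM f n.+1; rewrite eq_fg coef_fpsXM.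
Qed.

(** Both factors contribute to the order of vanishing: this is what makes the
    sum over the sizes of the last down step finite. *)
Lemma coef_fpsXnM_small f h k n :
  f 0%N = 0 -> h 0%N = 0 -> (n <= k)%N -> (f ^+ k * h) n = 0.
Proof.
move=> f0 h0 le_nk; rewrite coef_fpsM big_ord_recr /= subnn h0 mulr0 addr0.
rewrite big1 // => i _; rewrite coef_fpsX_small ?mul0r //.
exact: leq_trans (ltn_ord i) le_nk.
Qed.

Fact fpsC_is_zmod_morphism : zmod_morphism (@fpsC K).
Proof.
move=> a b; apply: fpsP => n.
by rewrite coef_fpsD coef_fpsN !fpsCE; case: (n == 0)%N; rewrite ?subr0.
Qed.

Fact fpsC_is_monoid_morphism : monoid_morphism (@fpsC K).
Proof.
split=> // a b; apply: fpsP => n.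
by rewrite coef_fpsCM !fpsCE; case: (n == 0)%N; rewrite ?mulr0.
Qed.

HB.instance Definition _ :=
  GRing.isZmodMorphism.Build K (fps K) (@fpsC K) fpsC_is_zmod_morphism.
HB.instance Definition _ :=
  GRing.isMonoidMorphism.Build K (fps K) (@fpsC K) fpsC_is_monoid_morphism.

(** A coefficient of a composite depends on finitely many coefficients of the
    outer series, so it may be computed by evaluating a polynomial; evaluation
    is a ring morphism, and composition inherits this. *)
Lemma coef_fps_comp_horner f h p n : h 0%N = 0 ->
    (forall i, (i <= n)%N -> p`_i = f i) ->
  fps_comp f h n = (map_poly (@fpsC K) p).[h] n.
Proof.
move=> h0 eq_pf; pose N := maxn n.+1 (size p).
rewrite (@horner_coef_wide _ N); last first.
  by rewrite (leq_trans (size_poly _ _)) // leq_maxr.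
rewrite coef_fps_sum -(big_mkord xpredT (fun i =>
  ((map_poly (@fpsC K) p)`_i * h ^+ i) n)).
rewrite (big_cat_nat (n := n.+1)) ?leq_maxl //.
rewrite [X in _ = _ + X]big_nat [X in _ = _ + X]big1; last first.
  move=> i /andP[lt_ni _].
  by rewrite coef_map coef_fpsCM coef_fpsX_small ?mulr0.
rewrite addr0 big_mkord; apply: eq_bigr => i _.
by rewrite coef_map coef_fpsCM eq_pf // -ltnS.
Qed.

Lemma fps_compM f g h : h 0%N = 0 ->
  fps_comp (f * g) h = fps_comp f h * fps_comp g h.
Proof.
move=> h0; apply: fpsP => n.
rewrite (coef_fps_comp_horner (p := fps_trunc n.+1 f * fps_trunc n.+1 g)) //.
  rewrite rmorphM hornerM !coef_fpsM; apply: eq_bigr => i _.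
  congr (_ * _); symmetry; apply: coef_fps_comp_horner => // j le_j;
    rewrite coef_fps_trunc //; have := ltn_ord i; lia.
by move=> i le_in; rewrite -fps_mul_trunc.
Qed.

Lemma fps_compD f g h : fps_comp (f + g) h = fps_comp f h + fps_comp g h.
Proof.
apply: fpsP => n; rewrite coef_fpsD /= -big_split.
by apply: eq_bigr => i _; exact: mulrDl.
Qed.

Lemma fps_comp1 h : h 0%N = 0 -> fps_comp 1 h = 1.
Proof.
move=> h0; apply: fpsP => n.
rewrite (coef_fps_comp_horner (p := 1)) ?rmorph1 ?hornerC // => i _.
by rewrite coef1 coef_fps1.
Qed.

Lemma fps_compX h : h 0%N = 0 -> fps_comp fpsX h = h.
Proof.
move=> h0; apply: fpsP => n.
rewrite (coef_fps_comp_horner (p := 'X)) ?map_polyX ?hornerX // => i _.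
by rewrite coefX.
Qed.

(** * Generating functions of the columns *)

Section Columns.
Variable g : fps K.
Hypothesis g_eq :
  (1 - fpsX ^+ 2) * g = 1 + fpsX * (1 - fpsX + fpsX ^+ 2) * g ^+ 2.
Let f := fpsX * g.

Lemma coef0_column : g 0%N = 1.
Proof.
move/(congr1 (fun h : fps K => h 0%N)): g_eq.
rewrite -mulrA coef_fpsM0 !coef_fpsD !coef_fpsN !expr2 !coef_fpsXM.
by rewrite coef_fps1 subr0 mul1r addr0.
Qed.

Definition flat_fps k :=
  if k is j.+1 then fpsX * (g * f ^+ k + g * f ^+ j) else 1 + fpsX * g.

(** This is [g * f ^+ k - flat_fps k]; the factored form shows that it vanishes
    to order at least [k + 1]. *)
Definition down_fps k := f ^+ k * (g - 1 - fpsX * g).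

Lemma flat_down_fps k : flat_fps k + down_fps k = g * f ^+ k.
Proof.
rewrite /flat_fps /down_fps; case: k => [|k]; first by rewrite !expr0; fps_ring.
by rewrite !exprS; set u := f ^+ k; rewrite /f; fps_ring.
Qed.

(** The difference of the two sides is [f ^+ k] times the defect of the
    quadratic equation of [g]. *)
Lemma down_fpsS k : down_fps k = fpsX * flat_fps k.+1 + down_fps k.+1.
Proof.
rewrite /down_fps /flat_fps /f !exprS; set u := _ ^+ k.
apply/eqP; rewrite -subr_eq0; apply/eqP.
transitivity (u * ((1 - fpsX ^+ 2) * g
  - (1 + fpsX * (1 - fpsX + fpsX ^+ 2) * g ^+ 2))); first by fps_ring.
by rewrite g_eq subrr mulr0.
Qed.
End Columns.

(** * The square root of 1 - 4 z *)

(** Completing the square in the quadratic equation of the Catalan series. *)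
Lemma fps_sqrt_catalanE f :
  (1 - f * (2%:R * fpsX)) ^+ 2 - (1 - 4%:R * fpsX)
    = 4%:R * (fpsX * (1 + fpsX * f ^+ 2 - f)).
Proof. fps_ring. Qed.

(** The Euler operator z d/dz: unlike d/dz it does not shift the coefficients,
    which keeps the Leibniz rule free of index changes. *)
Definition fps_theta f : fps K := Fps (fun n => n%:R * f n).

Lemma coef_fps_theta f n : fps_theta f n = n%:R * f n.
Proof. by []. Qed.

Lemma fps_thetaM f g : fps_theta (f * g) = fps_theta f * g + f * fps_theta g.
Proof.
apply: fpsP => n; rewrite coef_fpsD !coef_fpsM /= mulr_sumr -big_split.
apply: eq_bigr => i _ /=.
have {1}-> : n = (i + (n - i))%N by have := ltn_ord i; lia.
by rewrite natrD mulrDl mulrA (mulrCA _ (f i)).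
Qed.

Lemma fps_theta_sqr f : (1 - 4%:R * fpsX) * fps_theta f = - (2%:R * fpsX) * f ->
  (1 - 4%:R * fpsX) * fps_theta (f ^+ 2) = - (4%:R * fpsX) * f ^+ 2.
Proof.
move=> f_eq; rewrite expr2 fps_thetaM.
transitivity (2%:R * ((1 - 4%:R * fpsX) * fps_theta f) * f); first by fps_ring.
by rewrite f_eq; fps_ring.
Qed.

Lemma coef_fps_natM m f n : (m%:R * f) n = m%:R * f n.
Proof. by rewrite -(rmorph_nat (@fpsC K)) coef_fpsCM. Qed.

Lemma fps_theta_1B4X : fps_theta (1 - 4%:R * fpsX) = - (4%:R * fpsX).
Proof.
apply: fpsP => n.
rewrite coef_fps_theta coef_fpsD !coef_fpsN coef_fps_natM coef_fps1.
by case: n => [|[|n]]; rewrite ?(mul0r, mul1r, mulr0, sub0r, oppr0).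
Qed.

Lemma coef_fps_1B4XM f n : ((1 - 4%:R * fpsX) * f) n.+1 = f n.+1 - 4%:R * f n.
Proof.
by rewrite mulrBl mul1r coef_fpsD coef_fpsN -mulrA coef_fps_natM coef_fpsXM.
Qed.

End PowerSeries.

(** The coefficient of index [n.+1] of the equation gives
    [n.+1%:R * h n.+1] in terms of [h n], and [n.+1] is invertible. *)
Lemma fps_theta_eq_inj (f g : fps rat) : f 0%N = g 0%N ->
    (1 - 4%:R * fpsX) * fps_theta f = - (4%:R * fpsX) * f ->
    (1 - 4%:R * fpsX) * fps_theta g = - (4%:R * fpsX) * g ->
  f = g.
Proof.
move=> fg0 f_eq g_eq.
have recur (h : fps rat) n :
    (1 - 4%:R * fpsX) * fps_theta h = - (4%:R * fpsX) * h ->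
    n.+1%:R * h n.+1 = 4%:R * (n%:R * h n) - 4%:R * h n.
  move=> /(congr1 (fun h : fps rat => h n.+1)).
  rewrite coef_fps_1B4XM mulNr coef_fpsN -mulrA coef_fps_natM coef_fpsXM /=.
  by move/eqP; rewrite subr_eq addrC => /eqP.
apply: fpsP; elim=> // n IHn.
have n1_neq0 : n.+1%:R != 0 :> rat by rewrite pnatr_eq0.
by apply: (mulfI n1_neq0); rewrite !recur ?IHn.
Qed.

Definition central_fps : fps rat := Fps (fun n => ('C(n.*2, n))%:R).

Lemma central_binomialS n :
  (n.+1 * 'C(n.+1.*2, n.+1) = 2 * (n.*2.+1 * 'C(n.*2, n)))%N.
Proof.
have := mul_bin_diag n.*2.+1 n; have := mul_bin_down n.*2.+1 n.
have := mul_bin_diag n.*2.+2 n; rewrite !doubleS /=.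
have -> : (n.*2.+1 - n = n.+1)%N by lia.
nia.
Qed.

Definition catalan_sqrt : fps rat := 1 - catalan_fps * (2%:R * fpsX).

Lemma coef_catalan_sqrtS n :
  catalan_sqrt n.+1 = - (2%:R * catalan_fps n).
Proof.
rewrite /catalan_sqrt mulrCA [catalan_fps * _]mulrC coef_fpsD coef_fpsN.
by rewrite coef_fps_natM coef_fpsXM coef_fps1 /= sub0r.
Qed.

Lemma catalan_sqrt0 : catalan_sqrt 0%N = 1.
Proof.
rewrite /catalan_sqrt mulrCA [catalan_fps * _]mulrC coef_fpsD coef_fpsN.
by rewrite coef_fps_natM coef_fpsXM coef_fps1 mulr0 subr0.
Qed.

(** The factor [n.+1] produced by theta cancels the denominator of the Catalan
    number. *)
Lemma theta_catalan_sqrt :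
  fps_theta catalan_sqrt = - (2%:R * fpsX) * central_fps.
Proof.
apply: fpsP => n; rewrite mulNr coef_fpsN -mulrA coef_fps_natM coef_fpsXM.
rewrite coef_fps_theta.
case: n => [|n]; first by rewrite mul0r mulr0 oppr0.
rewrite coef_catalan_sqrtS mulrN mulrCA /=.
rewrite [_%:R * (_ / _)]mulrCA divff ?mulr1 //.
by rewrite pnatr_eq0.
Qed.

(** Coefficientwise, this is the recurrence of the central binomial
    coefficients divided by [n.+1]; the central series is 1 / sqrt(1 - 4 z). *)
Lemma catalan_sqrt_central : (1 - 4%:R * fpsX) * central_fps = catalan_sqrt.
Proof.
apply: fpsP => -[|n].
  rewrite catalan_sqrt0 coef_fpsM0 coef_fpsD coef_fpsN coef_fps_natM mulr0.
  by rewrite coef_fps1.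
rewrite coef_fps_1B4XM coef_catalan_sqrtS /=.
have n1_neq0 : n.+1%:R != 0 :> rat by rewrite pnatr_eq0.
apply: (mulfI n1_neq0); rewrite mulrBr mulrN [n.+1%:R * (2%:R * _)]mulrCA.
rewrite [n.+1%:R * (_ / _)]mulrCA divff // mulr1 -!natrM central_binomialS.
apply/eqP; rewrite subr_eq addrC eq_sym subr_eq -natrD eqr_nat.
by apply/eqP; lia.
Qed.

Lemma catalan_sqrtK : catalan_sqrt ^+ 2 = 1 - 4%:R * fpsX.
Proof.
apply: fps_theta_eq_inj.
- rewrite expr2 coef_fpsM0 catalan_sqrt0 mulr1 coef_fpsD coef_fpsN.
  by rewrite coef_fps_natM mulr0 subr0 coef_fps1.
- apply: fps_theta_sqr; rewrite theta_catalan_sqrt mulrCA.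
  by rewrite catalan_sqrt_central.
by rewrite fps_theta_1B4X mulrC.
Qed.

Lemma catalan_eq : catalan_fps = 1 + fpsX * catalan_fps ^+ 2.
Proof.
have: 4%:R * (fpsX * (1 + fpsX * catalan_fps ^+ 2 - catalan_fps))
    = 0 :> fps rat.
  by rewrite -fps_sqrt_catalanE -/catalan_sqrt catalan_sqrtK subrr.
move=> e4; apply/eqP; rewrite eq_sym -subr_eq0; apply/eqP.
apply: fpsXM_inj; rewrite mulr0; apply: fpsP => n; rewrite coef_fps0.
have four_neq0 : 4%:R != 0 :> rat by [].
by apply: (mulfI four_neq0); rewrite -coef_fps_natM e4 coef_fps0 mulr0.
Qed.

(** * Enumeration of the paths by last step *)

Lemma path_point_rcons p s i : (i <= size p)%N ->
  path_point (rcons p s) i = path_point p i.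
Proof. by move=> le_ip; rewrite /path_point -cats1 takel_cat. Qed.

Lemma path_point_rcons_size p s :
  path_point (rcons p s) (size p).+1 = path_point p (size p) + s.
Proof.
rewrite path_pointS ?size_rcons // path_point_rcons // nth_rcons.
by rewrite ltnn eqxx.
Qed.

Lemma end_height_rcons p s : end_height (rcons p s) = end_height p + s.2.
Proof. by rewrite /end_height size_rcons path_point_rcons_size. Qed.

Lemma nil_M1 : M1 [::].
Proof. by split=> // i _; rewrite /path_point /= big_nil. Qed.

(** The zero vector is the default value of [last] and [nth]: the empty path
    does not end with a down step. *)
Lemma not_down_steps0 : ~ down_steps 0.
Proof. by case=> k _. Qed.

Lemma not_down_stepsU : ~ down_steps stepU.
Proof. by case=> k k_gt0 [] /=; lia. Qed.

Lemma not_down_stepsH : ~ down_steps stepH.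
Proof. by case=> k k_gt0 [] /=; lia. Qed.

(** Adding a last step creates one new point, to the right of the previous one,
    and one new pair of consecutive steps: only these need to be checked. *)
Lemma M1_rcons p s : M1 (rcons p s) <->
  [/\ M1 p, s = stepU \/ s = stepH \/ down_steps s,
      0 <= end_height p + s.2
    & ~ (down_steps (last 0 p) /\ down_steps s)].
Proof.
split=> [[steps_ps pos_ps alt_ps]|[[steps_p pos_p alt_p] step_s ge0_h alt_s]].
  split.
  - split.
    + by move=> x x_p; apply: steps_ps; rewrite mem_rcons in_cons x_p orbT.
    + move=> i le_ip; rewrite -(path_point_rcons s le_ip).
      by apply: pos_ps; rewrite size_rcons leqW.
    move=> i lt_ip; have := alt_ps i; rewrite size_rcons !nth_rcons lt_ip.
    by rewrite (ltnW lt_ip); apply; rewrite ltnS ltnW.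
  - by apply: steps_ps; rewrite mem_rcons mem_head.
  - have [|_] := pos_ps (size p).+1; first by rewrite size_rcons.
    by rewrite path_point_rcons_size.
  (* For an empty p the last step is the default value, not a down step. *)
  have := alt_ps (size p).-1; rewrite -nth_last size_rcons !nth_rcons.
  case: p {steps_ps pos_ps alt_ps} => [|x p] alt.
    by case=> /not_down_steps0.
  by move: alt; rewrite /= !ltnSn ltnn eqxx; apply.
split.
- by move=> x; rewrite mem_rcons in_cons => /orP[/eqP -> //|]; apply: steps_p.
- move=> i; rewrite size_rcons leq_eqVlt => /orP[/eqP ->|]; last first.
    by rewrite ltnS => le_ip; rewrite path_point_rcons //; apply: pos_p.
  rewrite path_point_rcons_size; split=> //.
  have [ge0_1 _] := pos_p _ (leqnn _).
  by rewrite /= addr_ge0 //; case: step_s => [->|[->|[k _ ->]]].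
move=> i; rewrite size_rcons ltnS leq_eqVlt => /orP[/eqP def_i|lt_ip].
  rewrite !nth_rcons def_i ltnn eqxx -def_i ltnSn.
  by move: alt_s; rewrite -nth_last -def_i.
by rewrite !nth_rcons lt_ip (ltnW lt_ip); apply: alt_p.
Qed.

(** The flag [down] selects the paths that end with a down step.  A path of
    length [m] has height at most [m], so a down step that ends it cannot be
    larger than [m].  The range of [d] nevertheless goes up to [m.+1]: there,
    the remainder [down_fps g (k + m.+1) m.+1] vanishes for reasons of order
    alone. *)
Fixpoint M1_enum (n : nat) (down : bool) (k : nat) : seq (seq (int * int)) :=
  if n isn't m.+1 then if down || (0 < k)%N then [::] else [:: [::]] else
  if down then
    [seq rcons p (stepD d) | d <- iota 1 m.+1, p <- M1_enum m false (k + d)]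
  else
    [seq rcons p stepH | p <- M1_enum m false k ++ M1_enum m true k] ++
    (if k is j.+1 then
       [seq rcons p stepU | p <- M1_enum m false j ++ M1_enum m true j]
     else [::]).

(** Used instead of simplification, which would split off the first term of the
    range of [d]. *)
Lemma M1_enum_down n k : M1_enum n.+1 true k =
  [seq rcons p (stepD d) | d <- iota 1 n.+1, p <- M1_enum n false (k + d)].
Proof. by []. Qed.

Lemma mem_M1_enum n down k p :
  (p \in M1_enum n down k)
    <-> M1_paths n k p /\ `[< down_steps (last 0 p) >] = down.
Proof.
elim: n down k p => [|n IHn] down k p.
  have no_down : `[< down_steps 0 >] = false.
    by apply/asboolPn/not_down_steps0.
  split=> [|[[_ /size0nil -> /=]]]; rewrite /= ?no_down.
    case: down k => -[|k] //; rewrite inE => /eqP -> /=; split=> //.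
    by split=> //; [exact: nil_M1 | rewrite /end_height /path_point big_nil].
  rewrite /end_height /path_point big_nil => k0 <-.
  by case: k k0.
have in_cat j q :
    (q \in M1_enum n false j ++ M1_enum n true j) <-> M1_paths n j q.
  rewrite mem_cat; split=> [/orP[]/IHn[]// | Mq].
  by case down_q: `[< down_steps (last 0 q) >]; apply/orP; [right|left];
    apply/IHn.
split.
  case: down.
    rewrite M1_enum_down => /allpairsPdep[d [q [d_in /IHn[Mq_n flat_q] ->]]].
    case: Mq_n flat_q => Mq sz_q ht_q /asboolPn flat_q.
    have d_gt0 : (0 < d)%N by move: d_in; rewrite mem_iota => /andP[].
    have down_d : down_steps (stepD d) by exists d.
    split; last by rewrite last_rcons; apply/asboolP.
    split; rewrite ?size_rcons ?sz_q //; last first.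
      by rewrite end_height_rcons ht_q /=; lia.
    apply/M1_rcons; split=> //; first by right; right.
      by rewrite ht_q /=; lia.
    by case.
  rewrite /= mem_cat => /orP[/mapP[q /in_cat[Mq sz_q ht_q] ->]|].
    split; last by rewrite last_rcons; apply/asboolPn/not_down_stepsH.
    split; rewrite ?size_rcons ?sz_q //; last first.
      by rewrite end_height_rcons ht_q /= addr0.
    apply/M1_rcons; split=> //; [by right; left|by rewrite ht_q /=; lia|].
    by case=> _ /not_down_stepsH.
  case: k => [//|k] /mapP[q /in_cat[Mq sz_q ht_q] ->].
  split; last by rewrite last_rcons; apply/asboolPn/not_down_stepsU.
  split; rewrite ?size_rcons ?sz_q //; last first.
    by rewrite end_height_rcons ht_q /=; lia.
  apply/M1_rcons; split=> //; [by left|by rewrite ht_q /=; lia|].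
  by case=> _ /not_down_stepsU.
case=> [[]]; case/lastP: p => [//|p s] /M1_rcons[Mp step_s ge0_h alt_s].
rewrite size_rcons end_height_rcons last_rcons => -[sz_p] ht_p down_s.
have := path_point_le Mp (leqnn _); rewrite -/(end_height p) => le_h.
have ge0_p : 0 <= end_height p by case: Mp => _ /(_ _ (leqnn _))[].
case: step_s => [def_s|[def_s|down_sP]].
- rewrite def_s in down_s ht_p *.
  have -> : down = false by rewrite -down_s; apply/asboolPn/not_down_stepsU.
  rewrite /= mem_cat; apply/orP; right; case: k ht_p => [|k] /= ht_p.
    by lia.
  by apply/map_f/in_cat; split=> //; lia.
- rewrite def_s in down_s ht_p *.
  have -> : down = false by rewrite -down_s; apply/asboolPn/not_down_stepsH.
  rewrite /= mem_cat; apply/orP; left.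
  by apply/map_f/in_cat; split=> //; move: ht_p; rewrite addr0.
have -> : down = true by rewrite -down_s; apply/asboolP.
case: (down_sP) => d d_gt0 def_s; rewrite {}def_s in ht_p *; rewrite /= in ht_p.
rewrite M1_enum_down; apply/allpairsPdep; exists d, p; split=> //.
  by rewrite mem_iota; lia.
apply/IHn; split; first by split=> //; lia.
by apply/asboolPn => down_p; apply: alt_s.
Qed.

Lemma M1_enum_disjoint n k :
  ~~ has (mem (M1_enum n false k)) (M1_enum n true k).
Proof.
apply/hasPn => p /mem_M1_enum[_ down_p].
by apply/negP => /mem_M1_enum[_]; rewrite down_p.
Qed.

Lemma uniq_M1_enum n down k : uniq (M1_enum n down k).
Proof.
elim: n down k => [|n IHn] down k; first by rewrite /=; case: ifP.
have uniq_t j : uniq (M1_enum n false j ++ M1_enum n true j).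
  by rewrite cat_uniq !IHn M1_enum_disjoint.
case: down.
  rewrite M1_enum_down; apply: allpairs_uniq_dep => [|d _|];
    rewrite ?iota_uniq //.
  move=> [d p] [e q] _ _ /= /rcons_inj[-> ] => [[]] eq_de.
  by have -> : d = e by lia.
rewrite /=; have inj_s s : injective (fun p : seq (int * int) => rcons p s).
  by move=> p q /rcons_inj[].
rewrite cat_uniq map_inj_uniq // uniq_t /=; case: k => [//|k].
rewrite map_inj_uniq // uniq_t andbT; apply/hasPn => _ /mapP[p _ ->].
by apply/mapP => -[q _ /rcons_inj[_]].
Qed.

Lemma M1_countE n k :
  M1_count n k = (size (M1_enum n false k) + size (M1_enum n true k))%N.
Proof.
have uniq_t : uniq (M1_enum n false k ++ M1_enum n true k).
  by rewrite cat_uniq !uniq_M1_enum M1_enum_disjoint.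
rewrite -size_cat -(undup_id uniq_t) -card_fseq /M1_count; congr #|` _|.
apply/fsetP => p; rewrite in_fset_set; last exact: finite_M1_paths.
rewrite !inE; apply/idP/idP; rewrite in_setE.
  move=> Mp; case down_p: `[< down_steps (last 0 p) >]; apply/orP; [right|left];
    exact/mem_M1_enum.
by case/orP => /mem_M1_enum[].
Qed.

(** * Counting *)

(** Removing the last step gives recurrences for the sizes that the
    coefficients of [flat_fps] and [down_fps] also satisfy: for [flat_fps] by
    definition, for [down_fps] by telescoping [down_fpsS] until the remainder
    vanishes. *)
Lemma size_M1_enum (g : fps rat) :
    (1 - fpsX ^+ 2) * g = 1 + fpsX * (1 - fpsX + fpsX ^+ 2) * g ^+ 2 ->
  forall n k, (size (M1_enum n false k))%:R = flat_fps g k n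
    /\ (size (M1_enum n true k))%:R = down_fps g k n.
Proof.
move=> g_eq; set f := fpsX * g.
have g0 := coef0_column g_eq.
have down_small k n : (n <= k)%N -> down_fps g k n = 0.
  apply: coef_fpsXnM_small; first by rewrite coef_fpsXM.
  by rewrite !coef_fpsD !coef_fpsN coef_fps1 coef_fpsXM g0 oppr0 addr0 subrr.
have flatD n k : flat_fps g k n + down_fps g k n = (g * f ^+ k) n.
  by rewrite -(flat_down_fps g k).
elim=> [|n IHn] k.
  rewrite down_small // /flat_fps; case: k => [|k]; last by rewrite coef_fpsXM.
  by rewrite coef_fpsD coef_fps1 coef_fpsXM addr0.
have sizeD j :
    (size (M1_enum n false j ++ M1_enum n true j))%:R = (g * f ^+ j) n.
  by have [flat_j down_j] := IHn j; rewrite size_cat natrD flat_j down_j flatD.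
split.
  rewrite /= size_cat size_map natrD sizeD /flat_fps.
  case: k => [|k]; last by rewrite size_map sizeD coef_fpsXM coef_fpsD.
  by rewrite coef_fpsD coef_fps1 coef_fpsXM expr0 mulr1 addr0 add0r.
have telescope N : down_fps g k n.+1
    = \sum_(1 <= d < N.+1) flat_fps g (k + d) n + down_fps g (k + N) n.+1.
  elim: N => [|N IHN]; first by rewrite big_geq // add0r addn0.
  rewrite IHN [in RHS]big_nat_recr // -[RHS]addrA addnS; congr (_ + _).
  by rewrite (down_fpsS g_eq) coef_fpsD coef_fpsXM.
rewrite (telescope n.+1) down_small ?addr0 ?leq_addl //.
rewrite M1_enum_down size_allpairs_dep sumnE big_map natr_sum.
rewrite /index_iota subSS subn0.
by apply: eq_bigr => d _; have [] := IHn (k + d)%N.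
Qed.

Theorem proposition1 :
  let z : fps rat := fpsX in
  let C : fps rat := catalan_fps in
  let Cx : fps rat := fps_comp C (z * (1 - z + z ^+ 2) / (1 - z ^+ 2) ^+ 2) in
  let g : fps rat := (1 - z ^+ 2)^-1 * Cx in
  let f : fps rat := z / (1 - z ^+ 2) * Cx in
  (exists2 s : fps rat, is_fps_sqrt s (1 - 4%:R * z) & C * (2%:R * z) = 1 - s) /\
  riordan_pair g f /\
  forall n k : nat, (M1_count n k)%:R = riordan g f n k.
Proof.
move=> z C Cx g f; split.
  exists catalan_sqrt; last by rewrite subKr.
  by split; [exact: catalan_sqrt0 | exact: catalan_sqrtK].
have unit_d : 1 - z ^+ 2 \is a GRing.unit.
  rewrite unfold_in /= /fps_unit coef_fpsD coef_fpsN coef_fps1 expr2 coef_fpsXM.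
  by rewrite subr0 oner_eq0.
have f_def : f = z * g by rewrite /f /g mulrA.
have g_eq : (1 - z ^+ 2) * g = 1 + z * (1 - z + z ^+ 2) * g ^+ 2.
  pose w := z * (1 - z + z ^+ 2) / (1 - z ^+ 2) ^+ 2.
  have w0 : w 0%N = 0 by rewrite /w -mulrA coef_fpsXM.
  have Cx_eq : Cx = 1 + w * Cx ^+ 2.
    rewrite /Cx -/w {1}/C catalan_eq -/C fps_compD fps_compM // fps_comp1 //.
    by rewrite fps_compX // expr2 fps_compM.
  by rewrite /g mulVKr // exprMn exprVn mulrA -Cx_eq.
have g0 := coef0_column g_eq.
split=> [|n k]; first by split; rewrite ?f_def ?coef_fpsXM ?g0.
have [size_flat size_down] := size_M1_enum g_eq n k.
by rewrite M1_countE natrD size_flat size_down f_def /riordan -flat_down_fps.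
Qed.
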